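(* Let $p$ be an odd prime and write $p-1=2^n z$ with $z$ odd. Let $g\in\mathbb{F}_p^*$. Then: (1) $g\in\mathcal{G}_Z$ if and only if there exist $m\in\mathcal{G}_{QR}$ such that $m^{\frac{p-1}{2q}}\neq 1$ for every odd prime $q$ dividing $p-1$, and $r\in\mathcal{R}^{(n)}\setminus\mathcal{R}^{(n-1)}$, such that $g=mr$. (2) $g\in\mathcal{G}_Z$ if and only if $g\in\mathcal{G}_{QNR}$ and $g^{\frac{p-1}{q}}\neq 1$ for every odd prime $q$ dividing $p-1$.
   Context: $\mathbb{F}_p^*=(\mathbb{Z}/p\mathbb{Z})^\times$. $\mathcal{G}_Z$ is the set of primitive roots modulo $p$ (generators of $\mathbb{F}_p^*$). $\mathcal{G}_{QR}$ is the set of quadratic residues (non-zero squares) in $\mathbb{F}_p^*$, and $\mathcal{G}_{QNR}$ the set of quadratic non-residues in $\mathbb{F}_p^*$. The sets $\mathcal{R}^{(k)}\subset\mathbb{F}_p^*$ are defined recursively by $\mathcal{R}^{(0)}=\{1\}$ and $\mathcal{R}^{(k+1)}=\{x\in\mathbb{F}_p^* : x^2\in\mathcal{R}^{(k)}\}$. *)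

(* Defs.v *)
From HB Require Import structures.
From mathcomp Require Import all_boot all_algebra all_fingroup all_solvable.

Set Implicit Arguments.
Unset Strict Implicit.
Unset Printing Implicit Defensive.

Import GroupScope.

(* The multiplicative group F_p^* is the finite group {unit 'F_p}. The type 'F_p
   is the field Z/pZ when p is prime; for composite p it is the field of
   integers modulo the least prime divisor of p. *)

Definition primitive_roots (p : nat) : {set {unit 'F_p}} :=
  [set x | generator [set: {unit 'F_p}] x].

Definition quad_residues (p : nat) : {set {unit 'F_p}} :=
  [set x | [exists y : {unit 'F_p}, x == y ^+ 2]].

Definition quad_nonresidues (p : nat) : {set {unit 'F_p}} :=
  ~: quad_residues p.

Fixpoint iter_sqrt1 (p k : nat) : {set {unit 'F_p}} :=
  if k is k'.+1 then [set x | x ^+ 2 \in iter_sqrt1 p k'] else [set 1].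

(* Main.v *)
Require Import Defs.
From HB Require Import structures.
From mathcomp Require Import all_boot all_algebra all_fingroup all_solvable.

Import GroupScope.

(** The group of units of the field is cyclic of order [N = p - 1 = 2 ^ n * z].
    An element killed by [N] has order exactly [N] iff none of its powers with
    exponent [N %/ q], [q] a prime divisor of [N], is trivial
    ([order_eq_prime_test]). In a cyclic group of even order the test at
    [q = 2] is Euler's criterion: it fails exactly on the squares
    ([cyclic_square_iff]). Testing at [2] and at the odd primes separately
    gives [primitive_root_iff_nonresidue], which is part (2).

    For part (1), the [k]-th iterated square roots of [1] are the solutions of
    [x ^+ (2 ^ k) = 1], so [r] ranges over the elements of order exactly
    [2 ^ n]. A primitive root [g] is the product of its 2-part, which has order
    [2 ^ n], and its 2'-part, which has odd order [z] and is therefore a square.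
    Conversely, let [g = m * r]. At an odd [q] the factor [r] is invisible since
    [2 ^ n] divides [N %/ q], and [m ^+ (N %/ q)] is the square of
    [u = m ^+ (N %/ (2 * q))]; as [m] is a square, [u ^+ q = 1], so [u] has odd
    order and [u ^+ 2 = 1] would force [u = 1]. At [2] the factor [m] is
    invisible and [r ^+ (N %/ 2)] is nontrivial, so [g] passes the tests
    of part (2). *)

(** If [#[x]] is a proper divisor of [N], then [N %/ #[x]] has a prime factor
    [q], and [#[x]] still divides [N %/ q]: some test detects the defect. *)
Lemma order_eq_prime_test {gT : finGroupType} (x : gT) (N : nat) :
    (0 < N)%N -> x ^+ N = 1 ->
  (#[x] = N <-> forall q, prime q -> q %| N -> x ^+ (N %/ q) <> 1).
Proof.
move=> N_gt0 xN1; split=> [ox q q_pr qN /eqP|test].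
  rewrite -order_dvdn ox => /dvdn_leq; rewrite divn_gt0 ?prime_gt0 //.
  by move=> /(_ (dvdn_leq N_gt0 qN)); rewrite leqNgt ltn_Pdiv ?prime_gt1 ?N_gt0.
have /dvdnP[k Nk]: #[x] %| N by rewrite order_dvdn xN1.
have k_gt0 : (0 < k)%N by move: N_gt0; rewrite Nk muln_gt0 => /andP[].
have [k_le1|k_gt1] := leqP k 1.
  have k1 : k = 1%N by apply/eqP; rewrite eqn_leq k_le1.
  by rewrite Nk k1 mul1n.
have qk := pdiv_dvd k.
case: (test (pdiv k) (pdiv_prime k_gt1)).
  by rewrite Nk dvdn_mulr.
by rewrite {1}Nk -divn_mulAC // mulnC expgM expg_order expg1n.
Qed.

(** Euler's criterion. Writing [x = a ^+ k] for a generator [a], triviality of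
    [a ^+ (k * (#|G| %/ 2))] means that [#|G|] divides [k * (#|G| %/ 2)], that
    is, that [k] is even. *)
Lemma cyclic_square_iff {gT : finGroupType} (G : {group gT}) (x : gT) :
    cyclic G -> 2 %| #|G| -> x \in G ->
  (exists2 y, y \in G & x = y ^+ 2) <-> x ^+ (#|G| %/ 2) = 1.
Proof.
move=> /cyclicP[a defG] G2 xG; split=> [[y yG ->]|].
  by rewrite -expgM mulnC divnK // expg_cardG.
move: (xG); rewrite defG => /cycleP[k ->] /eqP.
rewrite -expgM -order_dvdn /order -defG.
have half_gt0 : (0 < #|G| %/ 2)%N by rewrite divn_gt0 // dvdn_leq.
rewrite -{1}(divnK G2) mulnC dvdn_pmul2r // => /dvdnP[j ->].
by exists (a ^+ j); rewrite ?expgM // defG mem_cycle.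
Qed.

(** With [k] the order of [x], [x ^+ k.+1 = x] and [k.+1] is even. *)
Lemma odd_order_square {gT : finGroupType} (x : gT) :
  odd #[x] -> exists y, x = y ^+ 2.
Proof.
move=> ox; exists (x ^+ (#[x].+1)./2).
by rewrite -expgM muln2 halfK /= ox subn0 expgS expg_order mulg1.
Qed.

Lemma iter_sqrt1E (p k : nat) (x : {unit 'F_p}) :
  (x \in iter_sqrt1 p k) = (x ^+ (2 ^ k) == 1).
Proof.
elim: k x => [|k IHk] x /=; first by rewrite inE expg1.
by rewrite inE IHk -expgM expnS.
Qed.

Lemma card_units_Fp (p : nat) : prime p -> #|[set: {unit 'F_p}]| = (p - 1)%N.
Proof. by move=> p_pr; rewrite card_finField_unit card_Fp // subn1. Qed.

Lemma units_Fp_abelian (p : nat) : abelian [set: {unit 'F_p}].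
Proof. exact/cyclic_abelian/field_unit_group_cyclic. Qed.

Lemma primitive_rootsE (p : nat) (g : {unit 'F_p}) :
  prime p -> (g \in primitive_roots p) = (#[g] == (p - 1)%N).
Proof.
move=> p_pr; rewrite inE /generator eq_sym eqEcard subsetT card_units_Fp //.
by rewrite eqn_leq -{2}card_units_Fp // [#[g] <= _]subset_leq_card ?subsetT.
Qed.

Lemma quad_residuesE (p : nat) (g : {unit 'F_p}) :
  prime p -> odd p -> (g \in quad_residues p) = (g ^+ ((p - 1) %/ 2) == 1).
Proof.
move=> p_pr p_odd.
have cardG := card_units_Fp p p_pr.
have p1_even : 2 %| #|[set: {unit 'F_p}]|.
  by rewrite cardG dvdn2 oddB ?prime_gt0 // p_odd.
have := cyclic_square_iff [set: {unit 'F_p}]%G g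
  (field_unit_group_cyclic _) p1_even (in_setT g).
rewrite /= cardG => euler; rewrite inE.
apply/existsP/eqP => [[y /eqP gy]|/euler[y _ ->]]; last by exists y.
by apply/euler; exists y; rewrite ?in_setT.
Qed.

(** Being a non-residue is the test of [order_eq_prime_test] at [2], by Euler's
    criterion; the remaining tests are those at odd primes. *)
Lemma primitive_root_iff_nonresidue (p : nat) (g : {unit 'F_p}) :
    prime p -> odd p ->
  g \in primitive_roots p <->
  g \in quad_nonresidues p /\
  (forall q, prime q -> odd q -> q %| p - 1 -> g ^+ ((p - 1) %/ q) <> 1).
Proof.
move=> p_pr p_odd.
have p1_gt0 : (0 < p - 1)%N by rewrite subn_gt0 prime_gt1.
have gp1 : g ^+ (p - 1) = 1 by rewrite -card_units_Fp // expg_cardG ?inE.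
have p1_even : 2 %| p - 1 by rewrite dvdn2 oddB ?prime_gt0 // p_odd.
have testP := order_eq_prime_test g (p - 1) p1_gt0 gp1.
rewrite primitive_rootsE // in_setC quad_residuesE //.
split=> [/eqP/testP test|[/eqP test2 test]].
  by split=> [|q q_pr _]; [apply/eqP; apply: test | apply: test].
apply/eqP/testP => q q_pr.
by have [->|/(test q q_pr)] := even_prime q_pr.
Qed.

Theorem theorem1 (p n z : nat) (p_prime : prime p) (p_odd : odd p)
    (z_odd : odd z) (p1E : (p - 1 = 2 ^ n * z)%N) (g : {unit 'F_p}) :
  (g \in primitive_roots p <->
   exists m r : {unit 'F_p},
     [/\ m \in quad_residues p,
         (forall q : nat, prime q -> odd q -> (q %| p - 1)%N ->
            m ^+ ((p - 1) %/ (2 * q)) <> 1),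
         r \in iter_sqrt1 p n :\: iter_sqrt1 p (n - 1)
       & g = m * r])
  /\
  (g \in primitive_roots p <->
   g \in quad_nonresidues p /\
   (forall q : nat, prime q -> odd q -> (q %| p - 1)%N ->
      g ^+ ((p - 1) %/ q) <> 1)).
Proof.
split; last exact: primitive_root_iff_nonresidue.
have p1_even : 2 %| p - 1 by rewrite dvdn2 oddB ?prime_gt0 // p_odd.
have z_gt0 := odd_gt0 z_odd.
(* [n] is positive because [p - 1] is even, so [n - 1] is a true predecessor. *)
case: n p1E => [|n] p1E; first by move: p1_even; rewrite p1E mul1n dvdn2 z_odd.
have half : ((p - 1) %/ 2 = 2 ^ n * z)%N.
  by rewrite p1E expnS -mulnA mulKn.
have odd_dvd q : odd q -> q %| p - 1 -> q %| z.
  by move=> q_odd; rewrite p1E Gauss_dvdr // coprimeXr // coprimen2.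
have quot2 q : q %| z -> ((p - 1) %/ (2 * q) = 2 ^ n * (z %/ q))%N.
  by move=> qz; rewrite divnMA half muln_divA.
have quot q : q %| z -> ((p - 1) %/ q = 2 ^ n.+1 * (z %/ q))%N.
  by move=> qz; rewrite p1E muln_divA.
have n1_subn1 : (n.+1 - 1 = n)%N by rewrite subn1.
have two_z : coprime (2 ^ n.+1) z by rewrite coprimeXl ?coprime2n.
rewrite n1_subn1; split=> [|[m [r [m_sq m_test]]]].
  rewrite primitive_rootsE // => /eqP og; rewrite p1E in og.
  have two_part : 2.-nat (2 ^ n.+1)%N by rewrite pnatX.
  have z_odd_part : 2^'.-nat z by rewrite -odd_2'nat.
  have or : #[g.`_2] = (2 ^ n.+1)%N.
    rewrite order_constt og partnM ?expn_gt0 // part_pnat_id //.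
    by rewrite part_p'nat ?muln1.
  have om : #[g.`_2^'] = z.
    rewrite order_constt og partnM ?expn_gt0 // part_p'nat ?pnatNK //.
    by rewrite part_pnat_id ?mul1n.
  exists g.`_2^', g.`_2; split; last by have := consttC 2^' g; rewrite consttNK.
  - have [|y ->] := odd_order_square g.`_2^'; first by rewrite om.
    by rewrite inE; apply/existsP; exists y.
  - move=> q q_pr q_odd /(odd_dvd q q_odd) qz /eqP.
    rewrite quot2 // -order_dvdn om Gauss_dvdr; last first.
      by rewrite coprime_sym coprimeXl ?coprime2n.
    have zq_gt0 : (0 < z %/ q)%N by rewrite divn_gt0 ?prime_gt0 // (dvdn_leq z_gt0 qz).
    by move/(dvdn_leq zq_gt0); rewrite leqNgt ltn_Pdiv ?prime_gt1.
  - rewrite in_setD !iter_sqrt1E -!order_dvdn or dvdnn andbT.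
    by rewrite dvdn_Pexp2l // ltnn.
rewrite in_setD !iter_sqrt1E => /andP[r_notn /eqP r_n1] ->.
have mrX k : (m * r) ^+ k = m ^+ k * r ^+ k.
  by apply/expgMn/(centsP (units_Fp_abelian p)); rewrite inE.
have m_half : m ^+ ((p - 1) %/ 2) = 1 by apply/eqP; rewrite -quad_residuesE.
apply/(primitive_root_iff_nonresidue p (m * r) p_prime p_odd); split=> [|q q_pr q_odd qp1].
  rewrite in_setC quad_residuesE // mrX m_half mul1g half -order_dvdn.
  rewrite Gauss_dvdl ?order_dvdn //.
  by apply: coprime_dvdl two_z; rewrite order_dvdn r_n1.
have qz := odd_dvd q q_odd qp1.
(* [u = m ^+ (_ %/ (2 * q))] satisfies [u ^+ q = 1], since [m] is a square; if
   also [u ^+ 2 = 1], the order of [u] divides [gcdn 2 q = 1]. *)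
rewrite mrX quot // [r ^+ _]expgM r_n1 expg1n mulg1 => mq1.
apply: (m_test q q_pr q_odd qp1); apply/eqP.
rewrite quot2 // -order_eq1 -dvdn1.
have gcd2q : gcdn 2 q = 1%N by apply/eqP; rewrite -/(coprime 2 q) coprime2n.
rewrite -[X in _ %| X]gcd2q dvdn_gcd !order_dvdn -!expgM mulnAC -expnSr mq1 eqxx.
by rewrite -mulnA divnK // -half m_half eqxx.
Qed.
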